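(* Let $(\Xi(t):t\ge0)$ be a continuous-time Markov process on $\mathcal X$ possessing a stationary distribution $\pi$ (not assumed unique), and suppose $\Phi:\mathcal X\to\mathbb R_+$ is a geometric Lyapunov function for it with geometric drift size $0<\gamma<1$, drift time $t_0>0$ and exception parameter $K$. Then $$\mathbb E_\pi[\Phi(\Xi(0))]\le\frac{\phi(t_0)\,K}{1-\gamma},\qquad\text{where }\ \phi(t)=\sup_{x\in\mathcal X}\Phi^{-1}(x)\,\mathbb E_x[\Phi(\Xi(t))].$$
   Context: $\mathcal X$ is a complete metrizable space (Euclidean space suffices) with its Borel $\sigma$-algebra; $\Phi$ is Borel measurable. $\mathbb E_x$ is expectation for the process started at $\Xi(0)=x$, and $\mathbb E_\pi$ is expectation when $\Xi(0)\sim\pi$. A probability $\pi$ on $\mathcal X$ is stationary if $\mathbb E_\pi[f(\Xi(0))]=\mathbb E_\pi[f(\Xi(t))]$ for every bounded continuous $f$ and all $t\ge0$. $\Phi:\mathcal X\to\mathbb R_+$ is a geometric Lyapunov function with geometric drift size $0<\gamma<1$, drift time $t_0>0$ and exception parameter $K\ge0$ if $$\sup_{x\in\mathcal X:\,\Phi(x)>K}\{\Phi(x)^{-1}\,\mathbb E_x[\Phi(\Xi(t_0))]\}\le\gamma .$$ Conventions: $\Phi^{-1}(x)$ means $1/\Phi(x)$; when $\Phi(x)=0$ the ratio $\Phi^{-1}(x)\mathbb E_x[\Phi(\Xi(t))]$ is read as $0$ if $\mathbb E_x[\Phi(\Xi(t))]=0$ and as $+\infty$ otherwise. The value $\phi(t_0)=+\infty$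 is not excluded; in that case the right-hand side of the bound is read as $+\infty$. *)

(* Defs.v *)
From HB Require Import structures.
From mathcomp Require Import all_boot all_order all_algebra.
From mathcomp Require Import all_classical all_reals all_analysis.
From mathcomp Require Import measurable_realfun kernel.

Set Implicit Arguments.
Unset Strict Implicit.
Unset Printing Implicit Defensive.
Import Order.TTheory GRing.Theory Num.Theory.
Import numFieldNormedType.Exports.
Local Open Scope classical_set_scope.
Local Open Scope ring_scope.
Local Open Scope ereal_scope.

Notation borel T := (g_sigma_algebraType (@open T)).

Section initial_law.
Context d d' (S : measurableType d) (Omega : measurableType d') (R : realType).
Variable P : R.-pker S ~> Omega.

(** The law [P x], repackaged so that it is seen as a [probability]. *)
Definition Pstart (x : S) : set Omega -> \bar R := P x.

HB.instance Definition _ (x : S) := Measure.on (Pstart x).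
HB.instance Definition _ (x : S) :=
  Measure_isProbability.Build _ _ _ (Pstart x) (prob_kernel x).

(** The law of the process when its initial point is drawn from [mu]. *)
Definition Pinit (mu : probability S R) (U : set Omega) : \bar R :=
  \int[mu]_x P x U.

Section measure.
Variable mu : probability S R.

Let Pinit0 : Pinit mu set0 = 0.
Proof. by rewrite /Pinit integral0_eq// => x _; rewrite measure0. Qed.

Let Pinit_ge0 U : 0 <= Pinit mu U.
Proof. exact: integral_ge0. Qed.

Let Pinit_sigma_additive : semi_sigma_additive (Pinit mu).
Proof.
move=> F mF tF mUF; rewrite [X in _ --> X](_ : _ =
    \sum_(n <oo) Pinit mu (F n)).
  by apply: is_cvg_nneseries => n _ _; exact: Pinit_ge0.
rewrite /Pinit -integral_nneseries//; last first.
  by move=> n; exact: measurable_kernel.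
by apply: eq_integral => x _; rewrite measure_semi_bigcup.
Qed.

HB.instance Definition _ := isMeasure.Build _ _ _ (Pinit mu)
  Pinit0 Pinit_ge0 Pinit_sigma_additive.

Let Pinit_setT : Pinit mu [set: Omega] = 1.
Proof.
rewrite /Pinit; under eq_integral do rewrite prob_kernel.
by rewrite integral_cst// mul1e; exact: probability_setT.
Qed.

HB.instance Definition _ :=
  Measure_isProbability.Build _ _ _ (Pinit mu) Pinit_setT.

End measure.
End initial_law.

Section process.
Context (R : realType) (X : ptopologicalType) d (Omega : measurableType d).
Variables (Xi : R -> Omega -> borel X) (P : R.-pker (borel X) ~> Omega).

(** The events determined by the process up to time [s]. *)
Definition past (s : R) : set (set Omega) :=
  <<s [set B | exists (u : R) (A : set (borel X)), [/\ (0 <= u <= s)%R, measurable A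
                             & B = Xi u @^-1` A]] >>.

(** [P x] is the law of the process started at [x]; only times [t >= 0] matter.
    In the Markov property, [g] is the conditional probability of [Xi t \in A]
    given the past up to time [s], as a function of the current state. It may
    depend on both [s] and [t], so time-homogeneity is allowed (take
    [g y = P y (Xi (t - s) @^-1` A)]) but not required. It does not depend on
    the starting point, so the process is also Markov under [Pinit P mu]. *)
Record markov_process : Prop := MarkovProcess {
  markov_measurable : forall t : R, (0 <= t)%R -> measurable_fun [set: Omega] (Xi t);
  markov_start : forall x, P x [set w | Xi 0%R w = x] = 1;
  markov_property : forall s t : R, (0 <= s <= t)%R ->
    forall A : set (borel X), measurable A ->
    exists g : borel X -> \bar R,
      [/\ measurable_fun [set: borel X] g, (forall y, 0 <= g y) &
        forall x B, past s B ->
          P x (B `&` Xi t @^-1` A) = \int[P x]_(w in B) g (Xi s w)] }.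

Definition stationary (pi : probability (borel X) R) : Prop :=
  forall f : X -> R, continuous f -> bounded_fun f ->
  forall t : R, (0 <= t)%R ->
    'E_(Pinit P pi)[fun w => f (Xi 0%R w)] = 'E_(Pinit P pi)[fun w => f (Xi t w)].

Variable Phi : X -> R.

(** Since [0^-1 = +oo] and [+oo * 0 = 0] in [\bar R], for [Phi x = 0] this is
    [0] when the expectation vanishes and [+oo] otherwise. *)
Definition growth_ratio (t : R) (x : X) : \bar R :=
  (Phi x)%:E^-1 * 'E_(Pstart P x)[fun w => Phi (Xi t w)].

Definition growth (t : R) : \bar R :=
  ereal_sup [set growth_ratio t x | x in [set: X]].

Record geometric_lyapunov (gamma t0 K : R) : Prop := GeometricLyapunov {
  lyapunov_ge0 : forall x, (0 <= Phi x)%R;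
  lyapunov_measurable : measurable_fun [set: borel X] (Phi : borel X -> R);
  drift_size_bounds : (0 < gamma < 1)%R;
  drift_time_gt0 : (0 < t0)%R;
  exception_ge0 : (0 <= K)%R;
  geometric_drift :
    ereal_sup [set growth_ratio t0 x | x in [set x | (K < Phi x)%R]]
      <= gamma%:E }.

End process.

(* Main.v *)
From HB Require Import structures.
Require Import Defs.
From mathcomp Require Import all_boot all_order all_algebra.
From mathcomp Require Import all_classical all_reals all_analysis.
From mathcomp Require Import measurable_realfun kernel giry.
From mathcomp Require Import lra.

(** Truncate: put f_n = min(Phi, n), whose pi-integral is finite. Stationarity,
    stated for bounded continuous functions only, extends to bounded Borel
    functions because the indicator of an open set of a metric space is an
    increasing limit of continuous functions; hence
    E_pi[E_x[f_n(Xi(t0))]] = E_pi[f_n]. The drift condition gives, pointwise,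
    E_x[f_n(Xi(t0))] + (f_n - gamma Phi)^+ <= f_n + phi(t0) K, so after
    integration and cancellation E_pi[(f_n - gamma Phi)^+] <= phi(t0) K, and
    monotone convergence yields (1 - gamma) E_pi[Phi] <= phi(t0) K. *)

Set Implicit Arguments.
Unset Strict Implicit.
Unset Printing Implicit Defensive.
Import Order.TTheory GRing.Theory Num.Theory.
Import numFieldNormedType.Exports.
Local Open Scope classical_set_scope.
Local Open Scope ring_scope.

(** * Continuity, Borel measurability and distance to a closed set *)

(** The balls of [\bar R] are those of the distance transported by [contract], so the ball of radius
    [e] is itself the required neighbourhood. *)
Lemma contract_continuous (R : realType) : continuous (@contract R).
Proof.
move=> x; apply/cvgrPdist_lt => e e0; near=> y.
by near: y; exact: (nbhsx_ballx (x : \bar R) e e0).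
Unshelve. all: by end_near. Qed.

Lemma continuous_borel_measurable (R : realType) (T : ptopologicalType)
    (f : T -> R) : continuous f -> measurable_fun [set: borel T] f.
Proof.
move=> /continuousP cf; apply: (measurability _ (RGenOpens.measurableE R)).
move=> _ [_ [a [b ->] <-]]; rewrite setTI.
by apply: sub_sigma_algebra; exact/cf/interval_open.
Qed.

(** An infimum equal to 0 puts points of [A] in every ball around [x], so [x] lies in the closure of
    [A]. *)
Lemma edist_inf_eq0_closed (R : realType) (T : pseudoMetricType R) (A : set T)
    (x : T) : closed A -> edist_inf A x = 0%E -> A x.
Proof.
move=> cA Ax0; apply: cA => U /nbhs_ballP [e /= e0 eU].
have fA : edist_inf A x \is a fin_num by rewrite Ax0.
have [_ [a Aa <-]] := lb_ereal_inf_adherent e0 fA.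
rewrite -/(edist_inf A x) Ax0 add0e => /edist_lt_ball xa.
by exists a; split => //; exact: eU.
Qed.

(** * Indicators of open sets as increasing limits of continuous functions *)

Section open_indicator.
Context (R : realType) (T : pseudoMetricType R).

(* [contract] maps \bar R onto [-1, 1], which handles infinite distances:
   the pseudometric is only given by its balls, and the complement of [U] may
   be empty. *)
Definition indic_approx (U : set T) (n : nat) (x : T) : R :=
  1 - (1 - contract (edist_inf (~` U) x)) ^+ n.

Variable U : set T.

Let contract_edist_ge0 x : 0 <= contract (edist_inf (~` U) x).
Proof. by rewrite -[X in X <= _](contract0 R) le_contract edist_inf_ge0. Qed.

Let contract_edist_le1 x : contract (edist_inf (~` U) x) <= 1.
Proof. exact: le_trans (ler_norm _) (contract_le1 _). Qed.

Lemma indic_approx_continuous n : continuous (indic_approx U n).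
Proof.
move=> x; apply: cvgB; first exact: cvg_cst.
have c (x' : T) :
    {for x', continuous (fun y => 1 - contract (edist_inf (~` U) y))}.
  apply: cvgB; first exact: cvg_cst.
  exact: (continuous_comp (@edist_inf_continuous _ _ _ x')
    (@contract_continuous R _)).
exact: (continuous_comp (c x) (@exprn_continuous R n _)).
Qed.

Lemma indic_approx_ge0 n x : 0 <= indic_approx U n x.
Proof. by rewrite subr_ge0 exprn_ile1// ?subr_ge0// gerBl. Qed.

Lemma indic_approx_le1 n x : indic_approx U n x <= 1.
Proof. by rewrite gerBl exprn_ge0// subr_ge0. Qed.

Lemma indic_approx_bounded n : bounded_fun (indic_approx U n).
Proof.
exists 1; split; first exact: num_real.
move=> M M1 x _ /=; rewrite ger0_norm ?indic_approx_ge0//.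
exact: le_trans (indic_approx_le1 n x) (ltW M1).
Qed.

Lemma nd_indic_approx x : nondecreasing_seq (indic_approx U ^~ x).
Proof. by move=> m n mn; rewrite lerB// ler_wiXn2l// ?subr_ge0// gerBl. Qed.

Lemma cvg_indic_approx x : open U ->
  indic_approx U n x @[n --> \oo] --> (\1_U x : R).
Proof.
move=> oU; rewrite indicE; have [/set_mem Ux|xU] := boolP (x \in U); last first.
  have Ux : (~` U) x by move=> /mem_set; exact/negP.
  rewrite [X in X @ _](_ : _ = cst 0); first exact: cvg_cst.
  apply/funext => n.
  by rewrite /indic_approx edist_inf0// contract0 subr0 expr1n subrr.
rewrite -[X in _ --> X]subr0; apply: cvgB; first exact: cvg_cst.
apply: cvg_expr; rewrite ger0_norm ?subr_ge0// gtrBl lt_neqAle contract_edist_ge0.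
rewrite eq_sym contract_eq0 andbT; apply/negP => /eqP Ux0.
by apply: (edist_inf_eq0_closed _ Ux0); first exact: open_closedC.
Qed.

End open_indicator.

(** * Equality of Borel probabilities and integration under [Pinit] *)

Local Open Scope ereal_scope.

(** Open sets are stable under intersection and generate the Borel sets, so agreement on them
    suffices; it follows by monotone convergence along [indic_approx]. *)
Lemma borel_probability_unique (R : realType) (T : pseudoPMetricType R)
    (m1 m2 : probability (borel T) R) :
    (forall f : T -> R, continuous f -> bounded_fun f ->
      (forall x, (0 <= f x)%R) ->
      \int[m1]_x (f x)%:E = \int[m2]_x (f x)%:E) ->
  forall A : set (borel T), measurable A -> m1 A = m2 A.
Proof.
move=> m12 A mA.
apply: (@g_sigma_algebra_measure_unique _ _ (borel T) (@open T) _
  (fun=> setT)) => //.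
- by move=> U oU; exact: sub_sigma_algebra.
- by move=> _; exact: openT.
- by rewrite bigcup_const//; exists 0%N.
- by move=> B C; exact: openI.
- move=> U oU.
  have mU : measurable (U : set (borel T)) by exact: sub_sigma_algebra.
  have lim_m (m : probability (borel T) R) :
      (\int[m]_x (indic_approx U n x)%:E) @[n --> \oo] --> m U.
    pose g (n : nat) (x : borel T) := (indic_approx U n x)%:E.
    have -> : m U = \int[m]_x limn (g ^~ x).
      rewrite -[LHS](congr1 m (setIT U)) -integral_indic//.
      apply: eq_integral => x _; apply/esym/cvg_lim => //; apply: cvg_EFin.
        exact: nearW.
      exact: cvg_indic_approx.
    apply: cvg_monotone_convergence => //.
    + move=> n; apply/measurable_EFinP; apply: continuous_borel_measurable.
      exact: indic_approx_continuous.
    + by move=> n x _; rewrite lee_fin indic_approx_ge0.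
    + by move=> x _ a b ab; rewrite lee_fin nd_indic_approx.
  rewrite -[LHS](cvg_lim (@ereal_hausdorff R) (lim_m m1)).
  rewrite -[RHS](cvg_lim (@ereal_hausdorff R) (lim_m m2)).
  apply/congr_lim/funext => n; apply: m12.
  - exact: indic_approx_continuous.
  - exact: indic_approx_bounded.
  - exact: indic_approx_ge0.
- by move=> _; rewrite [X in X < _](probability_setT m1) ltry.
Qed.

(** [Pinit P mu] is the bind of [mu] and [P] in the Giry monad, whose integration formula is this
    one. *)
Lemma integral_Pinit d d' (S : measurableType d) (Omega : measurableType d')
    (R : realType) (P : R.-pker S ~> Omega) (mu : probability S R)
    (h : Omega -> \bar R) :
    measurable_fun [set: Omega] h -> (forall w, 0 <= h w) ->
  \int[Pinit P mu]_w h w = \int[mu]_x \int[P x]_w h w.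
Proof.
move=> mh h0.
pose k : S -> giry Omega R := Pstart P.
have mk : measurable_fun [set: S] k.
  apply: measurable_giry_codensity => // B mB; exact: measurable_kernel.
have := @giry_int_bind _ _ _ _ _ (mu : subprobability S R) k mk h mh h0.
rewrite /giry_int => <-; apply: eq_measure_integral => A mA _ /=.
rewrite /giry_bind /giry_join /= /giry_int /giry_ev.
by rewrite ge0_integral_pushforward//; exact: measurable_giry_ev.
Qed.

(** * Laws of the process at time 0 and at time [t] *)

Section laws.
Context (R : realType) (X : pseudoPMetricType R) (X_metric : hausdorff_space X).
Context d (Omega : measurableType d) (Xi : R -> Omega -> borel X).
Context (P : R.-pker (borel X) ~> Omega) (Xi_markov : markov_process Xi P).

(** Points are closed in a Hausdorff space; this makes the event [Xi 0 = x] measurable. *)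
Lemma borel_measurable_set1 (x : borel X) : measurable [set x].
Proof.
rewrite -[X in measurable X]setCK; apply: measurableC; apply: sub_sigma_algebra.
apply: closed_openC.
exact: accessible_closed_set1 (hausdorff_accessible X_metric) x.
Qed.

(** Under [P x] the initial state is almost surely [x], so the inner integrand is almost everywhere
    the constant [f x]. *)
Lemma integral_initial (mu : probability (borel X) R) (f : borel X -> \bar R) :
    measurable_fun [set: borel X] f -> (forall x, 0 <= f x) ->
  \int[Pinit P mu]_w f (Xi 0%R w) = \int[mu]_x f x.
Proof.
move=> mf f0; have mXi0 := markov_measurable Xi_markov (lexx 0%R).
rewrite integral_Pinit//; last exact: measurableT_comp.
apply: eq_integral => x _.
have mE : measurable [set w | Xi 0%R w = x].
  rewrite -[X in measurable X]setTI.
  exact: mXi0 measurableT _ (borel_measurable_set1 x).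
transitivity (\int[P x]_w cst (f x) w); last first.
  by rewrite integral_cst// prob_kernel mule1.
have mfXi : measurable_fun [set: Omega] (f \o Xi 0%R) by exact: measurableT_comp.
apply: (ge0_ae_eq_integral measurableT mfXi (measurable_cst _)) => //=.
exists (~` [set w | Xi 0%R w = x]); split; first exact: measurableC.
  by rewrite [LHS](@probability_setC _ _ _ (Pstart P x) _ mE) /Pstart
    (markov_start Xi_markov) subee.
by move=> w /= + xw; apply => _; rewrite xw.
Qed.

(** The law of [Xi t] under [Pinit P pi] and [pi] itself integrate bounded continuous functions
    alike, hence are equal; [f] may then be any nonnegative Borel function. *)
Lemma integral_stationary (pi : probability (borel X) R)
    (pi_stationary : stationary Xi P pi) (t : R) (f : borel X -> \bar R) :
    (0 <= t)%R -> measurable_fun [set: borel X] f -> (forall x, 0 <= f x) ->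
  \int[Pinit P pi]_w f (Xi t w) = \int[pi]_x f x.
Proof.
move=> t0 mf f0; have mXi := markov_measurable Xi_markov t0.
pose mXi_mixin := isMeasurableFun.Build _ _ _ _ _ mXi.
pose Xt : {mfun Omega >-> borel X} := HB.pack (Xi t) mXi_mixin.
rewrite -[LHS](@ge0_integral_pushforward _ _ _ _ _ _ mXi (Pinit P pi) setT)//.
apply: eq_measure_integral => A mA _.
apply: (@borel_probability_unique R X (distribution (Pinit P pi) Xt) pi) => //.
move=> g cg bg g0.
have mg : measurable_fun [set: borel X] (EFin \o g).
  by apply/measurable_EFinP; exact: continuous_borel_measurable.
rewrite [LHS](ge0_integral_pushforward mXi _ measurableT mg (fun y _ => g0 y)).
(* Stationarity compares time [t] with time 0, where the law is [pi]. *)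
have := pi_stationary g cg bg t t0; rewrite unlock => <-.
by rewrite (@integral_initial pi (EFin \o g)).
Qed.

End laws.

(** * Consequences of the growth and drift bounds *)

Section drift.
Context (R : realType) (X : ptopologicalType) d (Omega : measurableType d).
Context (Xi : R -> Omega -> borel X) (P : R.-pker (borel X) ~> Omega).
Context (Phi : X -> R) (Phi_ge0 : forall x, (0 <= Phi x)%R).

Lemma growth_ratio_ge0 t x : 0 <= growth_ratio Xi P Phi t x.
Proof.
rewrite /growth_ratio mule_ge0// ?inve_ge0 ?lee_fin// unlock.
by apply: integral_ge0 => w _; rewrite lee_fin.
Qed.

Lemma growth_ratio_le t x (c : R) : growth_ratio Xi P Phi t x <= c%:E ->
  'E_(Pstart P x)[fun w => Phi (Xi t w)] <= (c * Phi x)%:E.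
Proof.
rewrite /growth_ratio; have [->|Phi0] := eqVneq (Phi x) 0%R.
  (* Here the ratio is [+oo] times the expectation, so a finite bound forces the expectation to
     vanish. *)
  rewrite inve0 mulr0.
  have : 0 <= 'E_(Pstart P x)[fun w => Phi (Xi t w)].
    by rewrite unlock; apply: integral_ge0 => w _; rewrite lee_fin.
  by rewrite le_eqVlt => /predU1P[<-//|/gt0_mulye ->]; rewrite leye_eq.
have Phi_gt0 : (0 < Phi x)%R by rewrite lt_neqAle eq_sym Phi0 Phi_ge0.
by rewrite inver (negbTE Phi0) lee_pdivrMl// mulrC EFinM.
Qed.

Lemma growth_ge0 t : 0 <= growth Xi P Phi t.
Proof.
apply: le_trans (growth_ratio_ge0 t point) _.
by apply: ereal_sup_ubound; exists point.
Qed.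

Lemma expectation_le_growth t x : growth Xi P Phi t != +oo ->
  'E_(Pstart P x)[fun w => Phi (Xi t w)]
    <= (fine (growth Xi P Phi t) * Phi x)%:E.
Proof.
move=> goo; apply: growth_ratio_le; rewrite fineK; last first.
  by rewrite ge0_fin_numE ?growth_ge0// ltey.
by apply: ereal_sup_ubound; exists x.
Qed.

End drift.

(* Here [e] is E_x[min(Phi(Xi(t0)), n)], whose pi-integral equals that of
   [Num.min f n]: the two cancel after integration. *)
Lemma drift_truncation (R : realDomainType) (e f n gamma p K : R) :
    (0 <= f)%R -> (0 <= n)%R -> (0 <= gamma <= 1)%R -> (0 <= p)%R -> (0 <= K)%R ->
    (e <= n)%R -> (e <= p * f)%R -> ((K < f)%R -> (e <= gamma * f)%R) ->
  (e + Num.max 0 (Num.min f n - gamma * f) <= Num.min f n + p * K)%R.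
Proof.
move=> f0 n0 /andP[g0 g1] p0 K0 en ep eg.
have gf : (gamma * f <= f)%R by rewrite ler_piMl.
have gf0 : (0 <= gamma * f)%R by rewrite mulr_ge0.
have pK0 : (0 <= p * K)%R by rewrite mulr_ge0.
(* Above [K], [e] is at most both [gamma * f] and [Num.min f n], one for each value of the maximum.
   Otherwise [e] is at most [p * K], and the maximum at most [Num.min f n]. *)
have [Kf|fK] := ltP K f.
  have {}eg := eg Kf.
  rewrite maxEle minEle; case: ifPn => [fn|nf]; case: ifPn => _; lra.
have pfK : (p * f <= p * K)%R by rewrite ler_wpM2l.
rewrite maxEle minEle; case: ifPn => [fn|nf]; case: ifPn => _; lra.
Qed.

(** * The bound on the stationary expectation *)

Theorem theorem5 (R : realType) (X : completePseudoMetricType R)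
  (X_metric : hausdorff_space X)
  (d : measure_display) (Omega : measurableType d)
  (Xi : R -> Omega -> borel X) (P : probability_kernel (borel X) Omega R)
  (Xi_markov : markov_process Xi P)
  (pi : probability (borel X) R) (pi_stationary : stationary Xi P pi)
  (Phi : X -> R) (gamma t0 K : R)
  (Phi_lyapunov : geometric_lyapunov Xi P Phi gamma t0 K) :
  let phi := growth Xi P Phi in
  ('E_(Pinit P pi)[fun w => Phi (Xi 0%R w)] <=
     (if phi t0 == +oo then +oo else phi t0 * K%:E / (1 - gamma)%:E))%E.
Proof.
case: Phi_lyapunov => Phi0 mPhi /andP[gamma0 gamma1] t00 K0 drift /=.
case: ifPn => [_|phi_oo]; first by rewrite leey.
have := expectation_le_growth Phi0 _ phi_oo; have := growth_ge0 Xi P Phi0 t0.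
have phi_fin : growth Xi P Phi t0 \is a fin_num.
  by rewrite ge0_fin_numE ?growth_ge0// ltey.
rewrite -(fineK phi_fin) /=.
set p := fine _; rewrite lee_fin => p0 Ep.
have Egamma x : (K < Phi x)%R ->
    'E_(Pstart P x)[fun w => Phi (Xi t0 w)] <= (gamma * Phi x)%:E.
  move=> KPhi; apply: (growth_ratio_le Phi0); apply: le_trans drift.
  by apply: ereal_sup_ubound; exists x.
rewrite unlock in Ep Egamma *.
have mXi := markov_measurable Xi_markov (ltW t00).
pose f n (x : borel X) : R := (Num.min (Phi x) n%:R)%R.
pose g n (x : borel X) : R := (Num.max 0 (f n x - gamma * Phi x))%R.
pose e n (x : borel X) := \int[P x]_w (f n (Xi t0 w))%:E.
have f0 n x : (0 <= f n x)%R by rewrite le_min Phi0 ler0n.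
have fn n x : (f n x <= n%:R)%R by rewrite ge_min lexx orbT.
have fPhi n x : (f n x <= Phi x)%R by rewrite ge_min lexx.
have mf n : measurable_fun [set: borel X] (f n) by exact: measurable_minr.
have mg n : measurable_fun [set: borel X] (g n).
  apply: measurable_maxr => //; apply: measurable_funB => //.
  exact: measurable_funM.
have mfXi n : measurable_fun [set: Omega] (fun w => (f n (Xi t0 w))%:E).
  by apply/measurable_EFinP; exact: measurableT_comp.
have e0 n x : 0 <= e n x by apply: integral_ge0 => w _; rewrite lee_fin.
have en n x : e n x <= n%:R%:E.
  rewrite -[leRHS]mule1 -(prob_kernel (s:=P) x) -integral_cst//.
  by apply: ge0_le_integral => // w _; rewrite lee_fin.
have ePhi n x : e n x <= \int[P x]_w (Phi (Xi t0 w))%:E.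
  apply: ge0_le_integral => //= [w _||w _]; rewrite ?lee_fin//.
  by apply/measurable_EFinP; apply: measurableT_comp mXi.
have me n : measurable_fun [set: borel X] (e n).
  apply: (@measurable_fun_integral_kernel _ _ _ _ _ P _
    (fun w => (f n (Xi t0 w))%:E)).
  - by move=> U mU; exact: measurable_kernel.
  - by move=> w; rewrite lee_fin.
  - exact: mfXi.
have pointwise n x : e n x + (g n x)%:E <= (f n x)%:E + (p * K)%:E.
  have efin : e n x \is a fin_num.
    by rewrite ge0_fin_numE// (le_lt_trans (en n x))// ltry.
  rewrite -(fineK efin) -!EFinD lee_fin.
  rewrite drift_truncation ?(ltW gamma0) ?(ltW gamma1)//.
  - by rewrite -lee_fin fineK.
  - by rewrite -lee_fin fineK// (le_trans (ePhi n x))//; exact: Ep.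
  - by move=> /Egamma; rewrite -lee_fin fineK//; exact: le_trans.
have mfE n : measurable_fun [set: borel X] (fun x => (f n x)%:E).
  exact/measurable_EFinP.
have fE0 n x : 0 <= (f n x)%:E by rewrite lee_fin.
(* Both sides are the integral of [f n (Xi t0 w)] under [Pinit P pi]. *)
have e_f n : \int[pi]_x e n x = \int[pi]_x (f n x)%:E.
  rewrite -(integral_stationary X_metric Xi_markov pi_stationary (ltW t00)
    (mfE n) (fE0 n)).
  by rewrite integral_Pinit// => w; exact: fE0.
(* This finiteness, gained by truncating, is what permits the cancellation below. *)
have f_fin n : \int[pi]_x (f n x)%:E \is a fin_num.
  rewrite ge0_fin_numE; last by apply: integral_ge0 => x _; rewrite lee_fin.
  apply: (@le_lt_trans _ _ (\int[pi]_x (cst n%:R%:E) x)).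
    by apply: ge0_le_integral => // x _; rewrite lee_fin.
  by rewrite integral_cst// [X in _ * X](probability_setT pi) mule1 ltry.
pose G n (x : borel X) := (g n x)%:E.
have mG n : measurable_fun [set: borel X] (G n) by exact/measurable_EFinP.
have G0 n x : 0 <= G n x by rewrite lee_fin le_max lexx.
have pK0 : 0 <= (p * K)%:E by rewrite lee_fin mulr_ge0.
have G_le n : \int[pi]_x G n x <= (p * K)%:E.
  (* The integral of [f n] is added to both sides and exchanged for that of [e n] on the left; as
     [pi] has mass 1, what remains is [pointwise] integrated. *)
  rewrite -(leeD2lE _ _ (f_fin n)) -{1}e_f -ge0_integralD//.
  rewrite -[X in _ + X]mule1 -(probability_setT pi) -integral_cst//.
  rewrite -ge0_integralD//.
  apply: ge0_le_integral => //.
  - by move=> x _; rewrite adde_ge0.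
  - exact: emeasurable_funD.
  - exact: emeasurable_funD.
have Phi_le : \int[pi]_x ((1 - gamma) * Phi x)%:E <= (p * K)%:E.
  have Gnd x : nondecreasing_seq (G ^~ x).
    move=> a b ab; rewrite lee_fin ge_max !le_max lexx/= lerD2r.
    apply/orP; right; rewrite le_min fPhi/=.
    by rewrite (le_trans (fn a x))// ler_nat.
  have Glim x : limn (G ^~ x) = ((1 - gamma) * Phi x)%:E.
    (* The sequence is constant as soon as [n] exceeds [Phi x]. *)
    apply/cvg_lim => //; apply: cvg_near_cst; near=> n.
    have Phin : (Phi x <= n%:R)%R by near: n; exact: nbhs_infty_ger.
    rewrite /G /g /f; congr EFin.
    rewrite (min_idPl Phin) -[X in (X - _)%R]mul1r -mulrBl.
    by apply/max_idPr; rewrite mulr_ge0// subr_ge0 ltW.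
  under eq_integral do rewrite -Glim.
  rewrite monotone_convergence//.
  apply: lime_le; last by apply: nearW => n; exact: G_le.
  apply: ereal_nondecreasing_is_cvgn => a b ab.
  by apply: ge0_le_integral => // x _; exact: Gnd.
have mPhiE : measurable_fun [set: borel X] (fun x => (Phi x)%:E).
  exact/measurable_EFinP.
have PhiE0 x : 0 <= (Phi x)%:E by rewrite lee_fin.
rewrite (integral_initial X_metric Xi_markov pi mPhiE PhiE0).
have gamma1' : (0 < 1 - gamma)%R by rewrite subr_gt0.
rewrite inver gt_eqF// lee_pdivlMr// muleC.
rewrite -ge0_integralZl// ?lee_fin ?(ltW gamma1')//.
Unshelve. all: by end_near. Qed.
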